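(* Let $0<p<1$. For every $(\alpha,\beta)\in\bar D_{c^*(p)}'$ the problem (S) with zero-value $(\alpha,\beta)$ has a solution $(x^*(\eta),y^*(\eta))$ on $\mathbb{R}$. Moreover, every such solution satisfies $(x^*(\eta),y^*(\eta))\in D_c$ for all $\eta\in\mathbb{R}\setminus\{0\}$, where $c=V(\alpha,\beta)$.
   Context: Fix $0<p<1$; $x|x|^{p-1}$ is taken to be $0$ at $x=0$. Problem (S) with zero-value $(\alpha,\beta)\in\mathbb{R}^2$ is $x'=y$, $y'=\frac{1}{1-p}x-x|x|^{p-1}-\frac12\eta y$, $(x(0),y(0))=(\alpha,\beta)$, where $'=d/d\eta$. A solution on an interval $J\ni 0$ is a bounded pair $(x,y)\in C^1(J)\cap L^\infty(J)$ satisfying these equations on $J$. Define $V(x,y)=\frac12y^2-\frac{1}{2(1-p)}x^2+\frac{1}{1+p}|x|^{1+p}$ on $\mathbb{R}^2$ and $c^*(p)=\frac{(1-p)^{2/(1-p)}}{2(1+p)}$. For $0\le c\le c^*(p)$, $D_c$ denotes the interior of the closed level curve $V=c$ surrounding the origin, i.e. $D_c=\{(x,y): |x|<(1-p)^{1/(1-p)},\ V(x,y)<c\}$; for $c=c^*(p)$ the closed curve is formed by the two level curves joining $(-(1-p)^{1/(1-p)},0)$ to $((1-p)^{1/(1-p)},0)$. Finally $\bar D_{c^*(p)}'=\bar D_{c^*(p)}\setminus\{(\pm(1-p)^{1/(1-p)},0),(0,0)\}$, where $\bar D_{c^*(p)}$ is the closure of $D_{c^*(p)}$. *)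

(* Defs.v *)
From HB Require Import structures.
From mathcomp Require Import all_boot all_order all_algebra.
From mathcomp Require Import all_classical all_reals all_analysis.

Set Implicit Arguments.
Unset Strict Implicit.
Unset Printing Implicit Defensive.

Import Order.TTheory GRing.Theory Num.Theory.
Import numFieldNormedType.Exports.

(* In this order, f^`() parses as the analytic derivative [derive1 f] and not
   as the formal derivative of a polynomial. *)
Local Open Scope ring_scope.
Local Open Scope classical_set_scope.

(* x|x|^(p-1); the leading factor x makes the value 0 at x = 0, whatever
   value [powR] assigns to 0 `^ (p - 1). *)
Definition signed_power (R : realType) (p x : R) : R := x * `|x| `^ (p - 1).

(* (x, y) is a solution of (S) on the whole line with zero-value (a, b):
   x and y are bounded, C^1 (differentiable with continuous derivative), and
   satisfy the system x' = y, y' = x/(1-p) - x|x|^(p-1) - ty/2. *)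
Definition solution (R : realType) (p a b : R) (x y : R -> R) : Prop :=
  [/\ [bounded x t | t in [set: R]] /\ [bounded y t | t in [set: R]],
      (forall t, derivable x t 1) /\ continuous x^`(),
      (forall t, derivable y t 1) /\ continuous y^`(),
      forall t, x^`() t = y t /\
        y^`() t = (1 - p)^-1 * x t - signed_power p (x t) - 2^-1 * t * y t
    & (x 0, y 0) = (a, b)].

Definition V (R : realType) (p : R) (z : R * R) : R :=
  2^-1 * z.2 ^+ 2 - (2 * (1 - p))^-1 * z.1 ^+ 2
  + (1 + p)^-1 * `|z.1| `^ (1 + p).

(* The positive zero of x/(1-p) - x|x|^(p-1). *)
Definition xeq (R : realType) (p : R) : R := (1 - p) `^ (1 - p)^-1.

Definition cstar (R : realType) (p : R) : R :=
  (1 - p) `^ (2 / (1 - p)) / (2 * (1 + p)).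

(* The interior of the closed level curve V = c around the origin; meaningful
   for 0 <= c <= cstar p, a range that is not enforced here. *)
Definition D (R : realType) (p c : R) : set (R * R) :=
  [set z | `|z.1| < xeq p /\ V p z < c].

Definition Dbar' (R : realType) (p : R) : set (R * R) :=
  closure (D p (cstar p)) `\` [set (- xeq p, 0); (xeq p, 0); (0, 0)].

(* Main.v *)
Require Import Defs.
From HB Require Import structures.
From mathcomp Require Import all_boot all_order all_algebra.
From mathcomp Require Import all_classical all_reals all_analysis.
From mathcomp Require Import zify ring lra.

Import Order.TTheory GRing.Theory Num.Theory.
Import numFieldNormedType.Exports.

Local Open Scope ring_scope.
Local Open Scope classical_set_scope.

(** Along a trajectory of (S) the energy satisfies [V' = - t y^2 / 2], so [V]
    decreases away from [t = 0], in forward time and, by the symmetry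
    [(x(t), y(t)) |-> (x(- t), - y(- t))], in backward time.  Equality
    [V(t) = V(0)] at some [t > 0] would force [y = 0] and then [y' = 0] between
    [0] and [t], making the zero-value a rest point, which is excluded.  Since
    [V >= c*] on the lines [|x| = xeq], the intermediate value theorem then keeps
    [|x| < xeq].

    The vector field is not Lipschitz at [x = 0], so existence comes from Peano's
    theorem.  As its growth is linear, the Euler scheme of step [1 / (n + 1)] is
    bounded on compact time intervals, hence has a pointwise limit along an
    ultrafilter on [nat].  No equicontinuity argument is needed: the bound
    [|z(t) - z(s) - (t - s) F(s, z(s))| <= e |t - s|] for [t] close to [s] holds up
    to [O(1/n)] for the step functions and passes to the pointwise limit. *)

(** * Peano's existence theorem *)

(** The difference quotient differs from [v] by this error divided by the increment. Without a
    quotient the estimate passes to limits and to coordinates. *)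
Lemma is_derive1_eps {R : realType} {W : normedModType R} (f : R -> W)
    (t : R) (v : W) :
  (forall e : R, 0 < e ->
    \forall u \near t, `|f u - f t - (u - t) *: v| <= e * `|u - t|) ->
  is_derive t 1 f v.
Proof.
move=> fv.
have cv : (fun h => h^-1 *: ((f \o shift t) (h *: (1 : R)) - f t)) @ 0^' --> v.
  apply/cvgrPdist_le => /= e e0.
  have /(fv _) [d /= d0 dP] := e0.
  exists d => //= h; rewrite /= sub0r normrN => hd h0.
  have /dP : `|t - (h + t)| < d by rewrite opprD addrCA subrr addr0 normrN.
  rewrite addrK => fvh.
  rewrite [_%:A]mulr1 distrC -[v in X in `|X|](scalerK h0) -scalerBr normrZ normfV.
  by rewrite ler_pdivrMl ?normr_gt0// mulrC.
by apply: DeriveDef; [apply/cvg_ex; exists v|exact: cvg_lim cv].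
Qed.

Fixpoint euler {R : realType} {V : normedModType R} (F : R -> V -> V) (z0 : V)
    (h : R) (k : nat) : V :=
  if k is k'.+1 then
    euler F z0 h k' + h *: F (k'%:R * h) (euler F z0 h k')
  else z0.

(** The difference telescopes: each step contributes [h *: (F - v)], of norm at most [e * h]. *)
Lemma euler_affine {R : realType} {V : normedModType R} (F : R -> V -> V)
    (z0 v : V) (h e : R) (j n : nat) : 0 <= h ->
  (forall i, (j <= i < j + n)%N ->
    `|F (i%:R * h) (euler F z0 h i) - v| <= e) ->
  `|euler F z0 h (j + n) - euler F z0 h j - (n%:R * h) *: v| <= e * (n%:R * h).
Proof.
move=> h0; elim: n => [|n IH] Fv.
  by rewrite addn0 subrr mul0r scale0r subrr normr0 mulr0.
have {}IH : `|euler F z0 h (j + n) - euler F z0 h j - (n%:R * h) *: v|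
    <= e * (n%:R * h).
  by apply: IH => i /andP[ji ijn]; apply: Fv; rewrite ji addnS ltnS ltnW.
have {}Fv := Fv (j + n)%N; rewrite leq_addr addnS ltnS leqnn in Fv.
have {}Fv := Fv isT; rewrite addnS /=.
set E := euler F z0 h (j + n) in Fv IH *; set Fn := F _ E in Fv *.
rewrite (_ : _ - _ = (E - euler F z0 h j - (n%:R * h) *: v) + h *: (Fn - v)).
  rewrite (le_trans (ler_normD _ _))// -natr1 mulrDl mul1r mulrDr lerD//.
  by rewrite normrZ ger0_norm// mulrC ler_wpM2r.
rewrite -natr1 mulrDl mul1r scalerDl scalerBr opprD.
by rewrite [X in X + _ = _]addrAC addrACA.
Qed.

(** Discrete Gronwall: one step multiplies [1 + |z|] by at most [1 + L * h <= expR (L * h)]. *)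
Lemma euler_bound {R : realType} {V : normedModType R} (F : R -> V -> V)
    (z0 : V) (h L T : R) (k : nat) : 0 <= h -> 0 <= L ->
  (forall t z, 0 <= t <= T -> `|F t z| <= L * (1 + `|z|)) ->
  k%:R * h <= T ->
  1 + `|euler F z0 h k| <= (1 + `|z0|) * expR (L * (k%:R * h)).
Proof.
move=> h0 L0 FL; elim: k => [|k IH] kT /=.
  by rewrite mul0r mulr0 expR0 mulr1.
have kT' : k%:R * h <= T.
  by apply: le_trans kT; rewrite ler_wpM2r// ler_nat.
have {}IH := IH kT'.
have kh0 : 0 <= k%:R * h by rewrite mulr_ge0.
have := FL (k%:R * h) (euler F z0 h k); rewrite kh0 kT' => /(_ isT) Fk.
have -> : L * (k.+1%:R * h) = L * (k%:R * h) + L * h by rewrite -natr1; ring.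
rewrite expRD (mulrA (1 + _)).
apply: le_trans (_ : (1 + `|euler F z0 h k|) * (1 + L * h) <= _).
  rewrite mulrDr mulr1 -addrA lerD2l (le_trans (ler_normD _ _))// lerD2l.
  rewrite normrZ ger0_norm// mulrC [_ * (L * h)]mulrA ler_wpM2r//.
  by rewrite [leRHS]mulrC.
apply: ler_pM => //; rewrite ?addr_ge0 ?mulr_ge0//.
exact: expR_ge1Dx.
Qed.

(** The image of an ultrafilter is an ultrafilter; as it contains the compact set [K], it
    converges. *)
Lemma ultra_limit {T : Type} {X : topologicalType} (U : set_system T)
    (K : set X) (f : T -> X) :
  UltraFilter U -> compact K -> (forall n, K (f n)) ->
  exists l : X, f @ U --> l.
Proof.
move=> UU; rewrite compact_ultra => Kc fK.
have UfU : UltraFilter (f @ U).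
  split; first exact: fmap_proper_filter.
  move=> G PG UG; apply/seteqP; split=> // A GA.
  case: (in_ultra_setVsetC (f @^-1` A) UU) => // nA.
  have : G (~` A) by exact: UG.
  move=> GnA; have := filterI GA GnA; rewrite setICr => G0.
  by case: (@filter_not_empty _ G _); exact: G0.
have UK : U (f @^-1` K) by apply: filterS filterT => n _; exact: fK.
by have [l [_ lP]] := Kc (f @ U) UfU UK; exists l.
Qed.

(** Exchanging [i] and [j] only changes a sign inside the norm, so [euler_affine] covers both
    orders. *)
Lemma euler_chord {R : realType} {V : normedModType R} (F : R -> V -> V)
    (z0 v : V) (h e : R) (i j : nat) : 0 <= h ->
  (forall l, (minn i j <= l < maxn i j)%N ->
    `|F (l%:R * h) (euler F z0 h l) - v| <= e) ->
  `|euler F z0 h i - euler F z0 h j - (i%:R * h - j%:R * h) *: v|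
    <= e * `|i%:R * h - j%:R * h|.
Proof.
move=> h0; wlog ji : i j / (j <= i)%N => [wl Fv|].
  have [/wl|/ltnW /wl] := leqP j i; first exact.
  rewrite minnC maxnC => /(_ Fv); rewrite (distrC (j%:R * h)).
  set a := euler F z0 h i; set b := euler F z0 h j.
  rewrite (_ : a - b - _ = - (b - a - (j%:R * h - i%:R * h) *: v)) ?normrN//.
  by rewrite !opprB [RHS]addrC -scaleNr opprB.
rewrite (minn_idPr ji) (maxn_idPl ji) => Fv.
have := @euler_affine _ _ F z0 v h e j (i - j) h0; rewrite subnKC// => /(_ Fv).
rewrite natrB// mulrBl [X in _ -> _ <= e * X]ger0_norm//.
by rewrite subr_ge0 ler_wpM2r// ler_nat.
Qed.

(** For grid points [a] and [b] whose cells of length [h] meet the interval between [t] and [s]: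
    both lie between [min - h] and [max]. *)
Lemma dist_le_span {R : realType} (t s h a b : R) :
  Num.min t s < a + h -> a <= Num.max t s ->
  Num.min t s < b + h -> b <= Num.max t s -> `|a - b| <= `|t - s| + h.
Proof. by rewrite ler_norml; case: (lerP t s) => *; lra. Qed.

Lemma peano_forward {R : realType} {V : normedModType R} (F : R -> V -> V)
    (z0 : V) :
  (forall M : R, compact [set z : V | `|z| <= M]) ->
  continuous (fun w : R * V => F w.1 w.2) ->
  (forall T : R, exists L : R, forall t z, 0 <= t <= T -> `|F t z| <= L * (1 + `|z|)) ->
  exists z : R -> V, z 0 = z0 /\
    forall s : R, 0 <= s -> forall e : R, 0 < e ->
      \forall t \near s, 0 <= t ->
        `|z t - z s - (t - s) *: F s (z s)| <= e * `|t - s|.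
Proof.
move=> cptV Fc Flin.
(* For [t >= 0], [k n t] is the index of the grid cell containing [t]. *)
pose h n : R := n.+1%:R^-1; pose k n (t : R) := Num.truncn (t * n.+1%:R).
have h_gt0 n : 0 < h n by rewrite invr_gt0.
have h_ge0 n : 0 <= h n by exact: ltW.
have kh n t : 0 <= t -> (k n t)%:R * h n <= t < (k n t)%:R * h n + h n.
  move=> t0; have : 0 <= t * n.+1%:R by rewrite mulr_ge0.
  move=> /truncn_itv /andP[kt tk].
  rewrite -[X in _ + X]mul1r -mulrDl natr1 /h.
  by rewrite ler_pdivrMr// ltr_pdivlMr// kt tk.
pose zn n t := euler F z0 (h n) (k n t).
(* One constant bounds nodes and slopes up to time [T], uniformly in the step size. *)
have bnd T : exists M : R, [/\ 1 <= M, forall n i, i%:R * h n <= T ->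
      `|euler F z0 (h n) i| <= M & forall n i, i%:R * h n <= T ->
      `|F (i%:R * h n) (euler F z0 (h n) i)| <= M].
  have [L LP] := Flin T.
  have {}LP t z : 0 <= t <= T -> `|F t z| <= `|L| * (1 + `|z|).
    by move=> /LP /le_trans; apply; rewrite ler_wpM2r ?addr_ge0// ler_norm.
  pose C := (1 + `|z0|) * expR (`|L| * T).
  have eC n i : i%:R * h n <= T -> 1 + `|euler F z0 (h n) i| <= C.
    move=> iT; apply: le_trans (euler_bound _ _ _ _ _ _ (h_ge0 n) (normr_ge0 L) LP iT) _.
    by rewrite ler_wpM2l ?addr_ge0// ler_expR ler_wpM2l.
  have C0 : 0 <= C by rewrite mulr_ge0 ?addr_ge0 ?expR_ge0.
  exists (1 + C + `|L| * C); split=> [|n i /eC iC|n i iT].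
  - by rewrite -addrA lerDl addr_ge0// mulr_ge0.
  - apply: (le_trans _ (_ : C <= _)); first by rewrite (le_trans _ iC)// lerDr.
    by rewrite -addrA addrCA lerDl addr_ge0// mulr_ge0.
  - apply: le_trans (LP _ _ _) _; first by rewrite mulr_ge0.
    apply: (le_trans _ (_ : `|L| * C <= _)); first by rewrite ler_wpM2l// eC.
    by rewrite lerDr addr_ge0.
(* A single ultrafilter finer than [\oo] serves all times at once, and [h n] still tends to 0 along
   it. *)
have [U [UU UF]] := @ultraFilterLemma nat \oo _.
have /choice[z zP] : forall t, exists l : V, zn ^~ t @ U --> l.
  move=> t; have [M [_ MP _]] := bnd `|t|.
  apply: (ultra_limit U _ (zn ^~ t) UU (cptV M)) => n /=; apply: MP.
  have [t0|t0] := leP 0 t; first by have /andP[+ _] := kh n _ t0; rewrite ger0_norm.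
  (* Truncation sends negative times to index 0, so the limit exists there too. *)
  rewrite /k (_ : Num.truncn _ = 0%N) ?mul0r//.
  by apply/truncn0Pn; rewrite -ltNge (lt_trans _ ltr01)// nmulr_rlt0.
have h0 : h @ U --> 0 by apply: cvg_trans cvg_harmonic => A /UF.
exists z; split.
  apply: (@cvg_unique _ (@norm_hausdorff _ V) (zn ^~ 0 @ U)) => //; first exact: zP.
  rewrite (_ : zn ^~ 0 = fun=> z0); first exact: cvg_cst.
  by apply/funext => n; rewrite /zn /k mul0r truncn0.
move=> s s0 e e0; set v := F s (z s).
have /cvgrPdist_le /(_ _ e0)/nbhs_ballP[d /= d0 dP] := Fc (s, z s).
have {}dP u w : `|s - u| < d -> `|z s - w| < d -> `|F u w - v| <= e.
  move=> su zw; rewrite distrC; apply: (dP (u, w)).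
  by split; rewrite -ball_normE.
have [M [M1 _ FM]] := bnd (s + 1).
have M0 : 0 < M by exact: lt_le_trans ltr01 M1.
(* For [|t - s|] and [h n] below [r], nodes between the two times move by less than
   [2 * r * M = d / 2]; with [d / 4] for the distance from [zn n s] to [z s] this stays below [d].
   Since [M >= 1], the times stay within [d / 2] as well. *)
pose r := d / (4 * M).
have r0 : 0 < r by rewrite divr_gt0// mulr_gt0.
have rd : r * M = d / 4 by rewrite /r; field; rewrite gt_eqF.
have rd4 : r <= d / 4 by rewrite -rd ler_peMr// ltW.
near=> t => t0.
have ts1 : `|t - s| < 1 by rewrite distrC; near: t; exact: (cvgr_dist_lt (fun x => x)).
have tsr : `|t - s| < r by rewrite distrC; near: t; exact: (cvgr_dist_lt (fun x => x)).
have lhs : `|zn n t - zn n s - (t - s) *: v| @[n --> U] -->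
    `|z t - z s - (t - s) *: v|.
  by apply: cvg_norm; apply: cvgB; [apply: cvgB; exact: zP|exact: cvg_cst].
(* Rounding [t] and [s] to the grid costs at most [h n] in length, hence the two extra terms, which
   vanish in the limit. *)
have rhs : e * (`|t - s| + h n) + h n * `|v| @[n --> U] --> e * `|t - s|.
  have tsh : `|t - s| + h n @[n --> U] --> `|t - s| + 0.
    by apply: (cvgD _ h0); exact: cvg_cst.
  have := cvgD (cvgMl_tmp (a := e) tsh) (cvgMr_tmp (b := `|v|) h0).
  by rewrite addr0 mul0r addr0 => H; exact: H.
apply: ler_cvg_to lhs rhs _.
near=> n.
have hr : h n < r.
  by near: n; move: h0 => /cvgrPdist_lt/(_ _ r0); apply: filterS => n; rewrite sub0r normrN ger0_norm.
have znd : `|z s - zn n s| < d / 4.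
  by near: n; apply: (cvgr_dist_lt _ _ (zP s)); rewrite divr_gt0.
have /andP[ks1 ks2] := kh n _ s0; have /andP[kt1 kt2] := kh n _ t0.
have iM i : (minn (k n t) (k n s) <= i <= maxn (k n t) (k n s))%N ->
    i%:R * h n <= Num.max t s /\ Num.min t s < i%:R * h n + h n.
  rewrite geq_min leq_max => /andP[ci1 ci2]; split.
    rewrite le_max; apply/orP; case/orP: ci2 => ci; [left|right].
      by apply: le_trans kt1; rewrite ler_wpM2r// ler_nat.
    by apply: le_trans ks1; rewrite ler_wpM2r// ler_nat.
  rewrite gt_min; apply/orP; case/orP: ci1 => ci; [left|right].
    by apply: lt_le_trans kt2 _; rewrite lerD2r ler_wpM2r// ler_nat.
  by apply: lt_le_trans ks2 _; rewrite lerD2r ler_wpM2r// ler_nat.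
have kts : `|(k n t)%:R * h n - (k n s)%:R * h n - (t - s)| <= h n.
  by clear -ks1 ks2 kt1 kt2; rewrite ler_norml; lra.
have : `|zn n t - zn n s - ((k n t)%:R * h n - (k n s)%:R * h n) *: v|
    <= e * `|(k n t)%:R * h n - (k n s)%:R * h n|.
  apply: euler_chord => // i /andP[i1 i2].
  have iks : (minn (k n t) (k n s) <= i <= maxn (k n t) (k n s))%N.
    by rewrite i1 ltnW.
  have [ih1 ih2] := iM _ iks.
  have it : `|(k n s)%:R * h n - i%:R * h n| <= `|t - s| + h n.
    by apply: dist_le_span => //; [rewrite gt_min ks2 orbT|rewrite le_max ks1 orbT].
  apply: dP.
    apply: (@le_lt_trans _ _ (`|t - s| + h n)); last first.
      by rewrite (lt_le_trans (ltrD tsr hr))//; clear -rd4 d0; lra.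
    apply: dist_le_span => //; last by rewrite le_max lexx orbT.
    by rewrite gt_min ltrDl h_gt0 orbT.
  (* Taking [v = 0] in the chord estimate turns the slope bound [M] into a Lipschitz bound on the
     nodes. *)
  have lip : `|zn n s - euler F z0 (h n) i| <= M * `|(k n s)%:R * h n - i%:R * h n|.
    have := @euler_chord _ _ F z0 0 (h n) M (k n s) i (h_ge0 n).
    rewrite scaler0 subr0; apply => l /andP[l1 l2]; rewrite subr0; apply: FM.
    have [|] := iM l; last first.
      move=> + _; rewrite le_max => /orP[|] /le_trans; apply; last by rewrite lerDl.
      by clear -ts1; move: ts1; rewrite ltr_norml; lra.
    by clear -iks l1 l2; lia.
  rewrite (le_lt_trans (ler_distD (zn n s) _ _))//.
  have : M * `|(k n s)%:R * h n - i%:R * h n| <= M * (`|t - s| + h n).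
    by rewrite ler_pM2l.
  have : M * (`|t - s| + h n) < M * (r + r) by rewrite ltr_pM2l// ltrD.
  by clear -rd znd lip d0; lra.
move=> chord.
rewrite (_ : _ - _ = zn n t - zn n s - ((k n t)%:R * h n - (k n s)%:R * h n) *: v +
   ((k n t)%:R * h n - (k n s)%:R * h n - (t - s)) *: v); last first.
  by rewrite [X in _ = _ + X]scalerBl addrA subrK.
rewrite (le_trans (ler_normD _ _))// lerD//.
  apply: (le_trans chord); rewrite ler_pM2l//.
  rewrite -[X in `|X|](subrK (t - s)) addrC.
  by rewrite (le_trans (ler_normD _ _))// lerD2l.
by rewrite normrZ ler_wpM2r.
Unshelve. all: by end_near.
Qed.

(** Two forward solutions are glued at 0: one for [F], one for the time-reversed field
    [- F (- s)]. *)
Lemma peano {R : realType} {V : normedModType R} (F : R -> V -> V) (z0 : V) :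
  (forall M : R, compact [set z : V | `|z| <= M]) ->
  continuous (fun w : R * V => F w.1 w.2) ->
  (forall T : R, exists L : R, forall t z, `|t| <= T -> `|F t z| <= L * (1 + `|z|)) ->
  exists z : R -> V, z 0 = z0 /\
    forall s e : R, 0 < e -> \forall t \near s,
      `|z t - z s - (t - s) *: F s (z s)| <= e * `|t - s|.
Proof.
move=> cptV Fc Flin.
have [|T|zp [zp0 zpP]] := @peano_forward _ _ F z0 cptV.
- exact: Fc.
- have [L LP] := Flin T; exists L => t z /andP[t0 tT]; apply: LP.
  by rewrite ger0_norm.
have [|T|zm [zm0 zmP]] := @peano_forward _ _ (fun s w => - F (- s) w) z0 cptV.
- move=> w; apply: continuousN.
  apply: (@continuous_comp _ _ _ (fun w : R * V => (- w.1, w.2))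
    (fun w : R * V => F w.1 w.2)); last exact: Fc.
  apply: (@cvg_pair _ _ _ _ (nbhs (- w.1)) (nbhs w.2)); last exact: cvg_snd.
  by apply: continuous_comp; [exact: cvg_fst|exact: opp_continuous].
- have [L LP] := Flin T; exists L => t z /andP[t0 tT]; rewrite normrN.
  by apply: LP; rewrite normrN ger0_norm.
pose z t := if 0 <= t then zp t else zm (- t).
have zN t : t <= 0 -> z t = zm (- t).
  rewrite /z le_eqVlt => /predU1P[->|t0]; first by rewrite lexx oppr0 zp0 zm0.
  by rewrite leNgt t0.
have zP t : 0 <= t -> z t = zp t by rewrite /z => ->.
exists z; split; first by rewrite zP.
move=> s e e0.
have right : 0 <= s -> \forall t \near s, 0 <= t ->
    `|z t - z s - (t - s) *: F s (z s)| <= e * `|t - s|.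
  move=> s0; apply: filterS (zpP s s0 e e0) => t tP t0.
  by rewrite !zP//; exact: tP.
have left : s <= 0 -> \forall t \near s, t <= 0 ->
    `|z t - z s - (t - s) *: F s (z s)| <= e * `|t - s|.
  move=> s0; have s0' : 0 <= - s by rewrite oppr_ge0.
  have : \forall t \near s, 0 <= - t -> `|zm (- t) - zm (- s) -
      (- t - - s) *: - F (- - s) (zm (- s))| <= e * `|- t - - s|.
    have oc : -%R @ s --> - s by exact: opp_continuous.
    exact: (oc _ (zmP (- s) s0' e e0)).
  apply: filterS => t; rewrite oppr_ge0 => tP t0; rewrite !zN//.
  have := tP t0; have -> : - t - - s = - (t - s) by rewrite opprB opprK addrC.
  by rewrite opprK scaleNr scalerN opprK normrN.
have [s0|s0|s0] := ltgtP s 0.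
- near=> t; have t0 : t <= 0.
    by near: t; exact: lt_le_nbhsl.
  by move: t0; near: t; exact: left (ltW s0).
- near=> t; have t0 : 0 <= t.
    by near: t; exact: lt_le_nbhsr.
  by move: t0; near: t; exact: right (ltW s0).
(* At the gluing point each half supplies the estimate on its own side. *)
- have s_ge0 : 0 <= s by rewrite s0.
  have s_le0 : s <= 0 by rewrite s0.
  near=> t; have [t0|/ltW t0] := leP 0 t.
    by move: t0; near: t; exact: right.
  by move: t0; near: t; exact: left.
Unshelve. all: by end_near.
Qed.

(** * Signed powers and the energy *)

Lemma norm_signed_power {R : realType} (p x : R) : 0 < p ->
  `|signed_power p x| = `|x| `^ p.
Proof.
by move=> p0; rewrite normrM (ger0_norm (powR_ge0 _ _)) mulr_powRB1.
Qed.

Lemma signed_powerN {R : realType} (p x : R) :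
  signed_power p (- x) = - signed_power p x.
Proof. by rewrite /signed_power normrN mulNr. Qed.

Lemma near0_norm_powR_le {R : realType} (p e : R) : 0 < p -> 0 < e ->
  \forall x \near (0 : R), `|x| `^ p <= e.
Proof.
move=> p0 e0; near=> x.
have xe : `|x| <= e `^ p^-1 by near: x; apply: (@nbhs0_le R R^o); exact: powR_gt0.
have := ge0_ler_powR (ltW p0) _ _ xe; rewrite !nnegrE normr_ge0 powR_ge0.
by rewrite -powRrM mulVf ?gt_eqF// (powRr1 (ltW e0)) => /(_ isT isT).
Unshelve. all: by end_near.
Qed.

(** The power rule settles [x > 0] and evenness [x < 0]. At 0 the function is [|u| * |u|^p], with
    second factor tending to 0. *)
Lemma is_derive_normr_powR {R : realType} (p x : R) : 0 < p ->
  is_derive x 1 (fun u : R => `|u| `^ (1 + p)) ((1 + p) * signed_power p x).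
Proof.
move=> p0.
have pos (z : R) : 0 < z ->
    is_derive z 1 (fun u : R => `|u| `^ (1 + p)) ((1 + p) * signed_power p z).
  move=> z0; rewrite /signed_power ger0_norm ?ltW// mulr_powRB1 ?ltW//.
  have := is_derive1_powR (1 + p) z0; rewrite (addrC 1 p) addrK.
  apply: near_eq_is_derive; near=> u.
  by rewrite ger0_norm//; near: u; exact: lt_le_nbhsr.
have [x0|x0|->] := ltgtP x 0.
- have Nx0 : 0 < - x by rewrite oppr_gt0.
  have := is_derive1_comp (pos _ Nx0) (is_deriveN (is_derive_id x 1)).
  rewrite (_ : _ \o _ = fun u : R => `|u| `^ (1 + p)); last first.
    by apply/funext => u /=; rewrite normrN.
  by rewrite signed_powerN !mulrN mulr1 opprK.
- exact: pos.
- apply: is_derive1_eps => e e0; near=> u.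
  rewrite normr0 powR0 ?gt_eqF ?addr_gt0// !subr0 /signed_power mul0r mulr0.
  rewrite scaler0 subr0 ger0_norm ?powR_ge0//.
  rewrite -mulr_powRB1 ?addr_gt0// (addrC 1 p) addrK mulrC ler_wpM2r//.
  by near: u; exact: near0_norm_powR_le.
Unshelve. all: by end_near.
Qed.

Lemma continuous_signed_power {R : realType} (p : R) : 0 < p ->
  continuous (signed_power p).
Proof.
move=> p0 x; have [->|x0] := eqVneq x 0.
  (* The factor with exponent [p - 1] may blow up at 0, so the product is estimated as a whole by
     [|x|^p]. *)
  rewrite /continuous_at {2}/signed_power mul0r.
  apply/cvgrPdist_le => e e0; near=> u.
  rewrite sub0r normrN norm_signed_power//.
  by near: u; exact: near0_norm_powR_le.
apply: cvgM; first exact: cvg_id.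
have c : {for `|x|, continuous (fun u : R => u `^ (p - 1))}.
  apply: differentiable_continuous; apply/derivable1_diffP.
  by have [] := @is_derive1_powR _ (p - 1) `|x|; rewrite ?normr_gt0.
exact: (continuous_cvg _ c (@norm_continuous _ R x)).
Unshelve. all: by end_near.
Qed.

Lemma signed_power_growth {R : realType} (p x : R) : 0 < p -> p < 1 ->
  `|signed_power p x| <= 1 + `|x|.
Proof.
move=> p0 p1; rewrite norm_signed_power//.
have [x1|/ltW x1] := leP `|x| 1.
  have := ge0_ler_powR (ltW p0) _ _ x1; rewrite !nnegrE normr_ge0 ler01 powR1.
  by move=> /(_ isT isT) /le_trans; apply; rewrite lerDl.
by rewrite (le_trans (ler1_powR x1 (ltW p1)))// lerDr.
Qed.

Lemma xeq_gt0 {R : realType} (p : R) : p < 1 -> 0 < xeq p.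
Proof. by move=> p1; rewrite powR_gt0// subr_gt0. Qed.

Lemma xeq_powR {R : realType} (p q : R) : p < 1 ->
  xeq p `^ q = (1 - p) `^ (q / (1 - p)).
Proof. by move=> p1; rewrite -powRrM mulrC. Qed.

(** Since [xeq^(1 + p) = xeq^2 / (1 - p)], the two terms in [x] add up to [xeq^2 / (2 * (1 + p))],
    which is [cstar p]. *)
Lemma V_xeq {R : realType} (p x y : R) : 0 < p -> p < 1 -> `|x| = xeq p ->
  V p (x, y) = 2^-1 * y ^+ 2 + cstar p.
Proof.
move=> p0 p1 xE; have q0 : 1 - p != 0 by rewrite subr_eq0 gt_eqF.
have q1 : 1 + p != 0 by rewrite gt_eqF// addr_gt0.
rewrite /V /= -addrA; congr (_ + _).
rewrite -(real_normK (num_real x)) xE -powR_mulrn ?powR_ge0// !xeq_powR// /cstar.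
have -> : (1 - p) `^ ((1 + p) / (1 - p)) = (1 - p) `^ (2 / (1 - p)) / (1 - p).
  rewrite (_ : (1 + p) / (1 - p) = 2 / (1 - p) - 1); last by field.
  by rewrite powRB ?q0 ?implybT// powRr1// subr_ge0 ltW.
by field; rewrite q0 q1.
Qed.

(** Cancelling [x != 0] leaves [|x|^(1 - p) = 1 - p], whose root is [xeq p]. *)
Lemma rest_point {R : realType} (p x : R) : 0 < p -> p < 1 ->
  (1 - p)^-1 * x - signed_power p x = 0 -> x = 0 \/ `|x| = xeq p.
Proof.
move=> p0 p1 /eqP; rewrite subr_eq0 /signed_power mulrC.
have [->|x0] := eqVneq x 0; first by left.
move=> /eqP /(mulfI x0) /esym.
rewrite -opprB powRN => /invr_inj xE.
have q0 : 1 - p != 0 by rewrite subr_eq0 gt_eqF.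
by right; rewrite /xeq -{1}xE -powRrM mulfV// powRr1.
Qed.

(** * Trajectories of (S) *)

(** The differential equations alone; boundedness is recovered later from the energy. *)
Definition trajectory {R : realType} (p : R) (x y : R -> R) : Prop :=
  forall t : R, is_derive t 1 x (y t) /\
    is_derive t 1 y ((1 - p)^-1 * x t - signed_power p (x t) - 2^-1 * t * y t).

(** The damping coefficient [t / 2] is odd, so reversing time and velocity preserves the system. *)
Lemma trajectory_rev {R : realType} (p : R) (x y : R -> R) :
  trajectory p x y -> trajectory p (fun t => x (- t)) (fun t => - y (- t)).
Proof.
move=> xy t; have [dx dy] := xy (- t).
have dN := is_deriveN (is_derive_id t (1 : R)).
split; first by apply: (is_derive_eq (is_derive1_comp dx dN)); rewrite mulrN1.
apply: (is_derive_eq (is_deriveN (is_derive1_comp dy dN))).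
by rewrite /=; ring.
Qed.

Lemma trajectory_continuous {R : realType} (p : R) (x y : R -> R) :
  trajectory p x y -> continuous x /\ continuous y.
Proof.
move=> xy; split=> t; apply: differentiable_continuous; apply/derivable1_diffP.
  by have [[]] := xy t.
by have [_ []] := xy t.
Qed.

Lemma V_rev {R : realType} (p x y : R) : V p (x, - y) = V p (x, y).
Proof. by rewrite /V /= sqrrN. Qed.

Lemma is_derive_V {R : realType} (p : R) (x y : R -> R) (t : R) :
  0 < p -> p < 1 -> trajectory p x y ->
  is_derive t 1 (fun s => V p (x s, y s)) (- (2^-1 * t * y t ^+ 2)).
Proof.
move=> p0 p1 /(_ t) [dx dy].
have dxp := is_derive1_comp (is_derive_normr_powR p (x t) p0) dx.
have q0 : 1 - p != 0 by rewrite subr_eq0 gt_eqF.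
have q1 : 1 + p != 0 by rewrite gt_eqF// addr_gt0.
have dV := is_deriveD (is_deriveB (is_deriveZ 2^-1 (is_deriveX 2 dy))
  (is_deriveZ (2 * (1 - p))^-1 (is_deriveX 2 dx))) (is_deriveZ (1 + p)^-1 dxp).
rewrite (_ : (fun s => _) = 2^-1 *: y ^+ 2 - (2 * (1 - p))^-1 *: x ^+ 2
  + (1 + p)^-1 *: ((fun u => `|u| `^ (1 + p)) \o x)); last by [].
apply: (is_derive_eq dV); rewrite /GRing.scale /= !expr1.
by field; rewrite q0 q1.
Qed.

Lemma V_decr {R : realType} (p : R) (x y : R -> R) :
  0 < p -> p < 1 -> trajectory p x y ->
  forall s t : R, 0 <= s -> s <= t -> V p (x t, y t) <= V p (x s, y s).
Proof.
move=> p0 p1 xy s t s0 st.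
have dV u := is_derive_V p x y u p0 p1 xy.
apply: (@ler0_derive1_nincr R (fun s => V p (x s, y s)) 0 t) => //.
- move=> u; rewrite in_itv /= => /andP[u0 _].
  rewrite derive1E; have [_ ->] := dV u.
  by rewrite oppr_le0 mulr_ge0 ?sqr_ge0// mulr_ge0// ltW.
- apply: continuous_subspaceT => u.
  by apply: differentiable_continuous; apply/derivable1_diffP; have [] := dV u.
Qed.

Lemma eq0_right_limit {R : realType} (f : R -> R) (t : R) : 0 < t ->
  {for 0, continuous f} -> (forall s, 0 < s < t -> f s = 0) -> f 0 = 0.
Proof.
move=> t0 fc f0; apply: (@cvg_unique _ (@norm_hausdorff _ R) (f @ 0^'+)).
  exact: cvg_at_right_filter.
apply: cvg_near_cst; near=> s; apply: f0; apply/andP; split.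
  by near: s; exact: nbhs_right_gt.
by near: s; exact: nbhs_right_lt.
Unshelve. all: by end_near.
Qed.

Lemma V_strict_decr {R : realType} (p : R) (x y : R -> R) :
  0 < p -> p < 1 -> trajectory p x y ->
  ~ (y 0 = 0 /\ (1 - p)^-1 * x 0 - signed_power p (x 0) = 0) ->
  forall t : R, 0 < t -> V p (x t, y t) < V p (x 0, y 0).
Proof.
move=> p0 p1 xy nrest t t0.
rewrite lt_neqAle V_decr// ?ltW// andbT; apply/eqP => Vt; apply: nrest.
have [xc yc] := trajectory_continuous _ _ _ xy.
have Vs s : 0 < s < t -> V p (x s, y s) = V p (x 0, y 0).
  (* Monotonicity squeezes [V] between its equal values at 0 and [t]. *)
  move=> /andP[s0 st]; apply/eqP; rewrite eq_le V_decr ?(ltW s0)//=.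
  by rewrite -Vt V_decr ?ltW.
have near_in s : 0 < s < t -> \forall u \near s, 0 < u < t.
  move=> /andP[s0 st]; near=> u; apply/andP; split; near: u.
    exact: lt_nbhsr.
  exact: lt_nbhsl.
have ys s : 0 < s < t -> y s = 0.
  (* [V] is constant near [s], so [s * y s ^+ 2 / 2 = 0] with [s > 0]. *)
  move=> st; have [_] := is_derive_V p x y s p0 p1 xy.
  rewrite (@near_eq_derive _ _ _ _ (cst (V p (x 0, y 0)))); last first.
    by apply: filterS (near_in s st) => u ut; rewrite Vs.
  rewrite derive_cst => /esym/eqP; rewrite oppr_eq0 mulf_eq0 sqrf_eq0.
  by move: st => /andP[s0 _]; rewrite mulf_eq0 invr_eq0 pnatr_eq0/= gt_eqF// => /eqP.
have y0 : y 0 = 0 by apply: (@eq0_right_limit _ y t t0) => //; exact: yc.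
split => //.
apply: (@eq0_right_limit _ (fun s => (1 - p)^-1 * x s - signed_power p (x s)) t t0).
  apply: cvgB; first by apply: cvgMl_tmp; exact: xc.
  apply: continuous_cvg; [exact: continuous_signed_power|exact: xc].
(* As [y] vanishes near [s], so does [y'] at [s], and the equation leaves only the force term. *)
move=> s st; have [_ [_]] := xy s.
rewrite (@near_eq_derive _ _ _ _ (cst 0)); last first.
  by apply: filterS (near_in s st) => u ut; rewrite ys.
by rewrite derive_cst ys// mulr0 subr0.
Unshelve. all: by end_near.
Qed.

Lemma trajectory_in_D {R : realType} (p : R) (x y : R -> R) :
  0 < p -> p < 1 -> trajectory p x y -> `|x 0| < xeq p ->
  V p (x 0, y 0) <= cstar p -> (x 0, y 0) != (0, 0) ->
  forall t : R, 0 < t -> D p (V p (x 0, y 0)) (x t, y t).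
Proof.
move=> p0 p1 xy x0 Vc n0 t t0.
have [xc _] := trajectory_continuous _ _ _ xy.
have Vlt s : 0 < s -> V p (x s, y s) < V p (x 0, y 0).
  apply: V_strict_decr => // -[y00 /(rest_point _ _ p0 p1) [x00|xE]].
    by move: n0; rewrite x00 y00 eqxx.
  by move: x0; rewrite xE ltxx.
split; last exact: Vlt.
rewrite /= ltNge; apply/negP => xt.
(* At the first component's crossing of [xeq p] the energy is at least [cstar p], against [Vlt]. *)
have [||s] := @IVT R (fun s => `|x s|) 0 t (xeq p) (ltW t0).
- apply: continuous_subspaceT => s; apply: cvg_norm; exact: xc.
- by rewrite ge_min le_max (ltW x0) xt orbT.
rewrite in_itv /= => /andP[]; rewrite le_eqVlt => /predU1P[<- _ xE|s0 _ xs].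
  by move: x0; rewrite xE ltxx.
have := Vlt _ s0; rewrite V_xeq// => /lt_le_trans/(_ Vc).
by rewrite ltNge lerDr mulr_ge0// sqr_ge0.
Qed.

(** * Existence of trajectories with arbitrary zero-value *)

Lemma prod_norm_max {R : realType} (w : R * R) : `|w| = Num.max `|w.1| `|w.2|.
Proof. by []. Qed.

Lemma compact_prod_ball {R : realType} (M : R) :
  compact [set w : R * R | `|w| <= M].
Proof.
rewrite (_ : [set w | _] = `[- M, M]%classic `*` `[- M, M]%classic).
  by apply: compact_setX; exact: segment_compact.
apply/seteqP; split => w /=; rewrite prod_norm_max ge_max !in_itv /= !ler_norml.
  by move=> /andP[].
by case=> -> ->.
Qed.

Lemma trajectory_exists {R : realType} (p a b : R) : 0 < p -> p < 1 ->
  exists x y : R -> R, trajectory p x y /\ (x 0, y 0) = (a, b).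
Proof.
move=> p0 p1.
pose g (t : R) (w : R * R) : R :=
  (1 - p)^-1 * w.1 - signed_power p w.1 - 2^-1 * t * w.2.
have [||z [z0 zP]] := @peano _ _ (fun (t : R) (w : R * R) => (w.2, g t w)) (a, b)
  compact_prod_ball.
- move=> [t w].
  have /(_ (t, w)) w1 : continuous (fun v : R * (R * R) => v.2.1).
    by move=> v; apply: continuous_comp; [exact: cvg_snd|exact: cvg_fst].
  have /(_ (t, w)) w2 : continuous (fun v : R * (R * R) => v.2.2).
    by move=> v; apply: continuous_comp; exact: cvg_snd.
  apply: (@cvg_pair _ _ _ _ (nbhs w.2) (nbhs (g t w))) => //.
  apply: cvgB; last first.
    by apply: cvgM => //; apply: cvgMl_tmp; exact: cvg_fst.
  apply: cvgB; first exact: cvgMl_tmp.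
  exact: (continuous_cvg _ (@continuous_signed_power _ _ p0 w.1) w1).
(* The summands account for the linear term, the signed power and the damping; the 1 also covers the
   first component [w.2]. *)
- move=> T; exists ((1 - p)^-1 + 1 + `|T|) => t w tT.
  have q0 : 0 <= (1 - p)^-1 by rewrite invr_ge0 subr_ge0 ltW.
  have [w1 w2] : `|w.1| <= `|w| /\ `|w.2| <= `|w|.
    by rewrite [X in _ <= X /\ _ <= X]prod_norm_max !le_max !lexx orbT.
  have T0 : 0 <= `|T| := normr_ge0 T.
  have tT' : `|t| <= `|T| := le_trans tT (ler_norm T).
  have w0 : 0 <= `|w| := normr_ge0 w.
  rewrite [leLHS]prod_norm_max ge_max /=; apply/andP; split.
    by apply: (le_trans w2); nra.
  have e1 := signed_power_growth p w.1 p0 p1.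
  have e2 : `|(1 - p)^-1 * w.1| <= (1 - p)^-1 * `|w|.
    by rewrite normrM ger0_norm// ler_wpM2l.
  have e3 : `|2^-1 * t * w.2| <= `|T| * `|w|.
    rewrite !normrM ler_pM// ger0_norm//.
    by rewrite (le_trans _ tT')// ler_piMl// invf_le1// ler1n.
  rewrite (le_trans (ler_normB _ _))// (le_trans (lerD (ler_normB _ _) e3))//.
  by nra.
exists (fst \o z), (snd \o z); split; last by rewrite /= z0.
move=> t; split; apply: is_derive1_eps => e e0; apply: filterS (zP t e e0) => u.
  by apply: le_trans; rewrite prod_norm_max le_max lexx.
by apply: le_trans; rewrite prod_norm_max le_max lexx orbT.
Qed.

(** * Solutions, invariance and boundedness *)

Lemma solution_trajectory {R : realType} (p a b : R) (x y : R -> R) :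
  solution p a b x y -> trajectory p x y.
Proof.
case=> _ [dx _] [dy _] xy _ t; have [xE yE] := xy t.
by split; apply: DeriveDef; rewrite -?derive1E.
Qed.

Lemma trajectory_solution {R : realType} (p a b : R) (x y : R -> R) :
  0 < p -> trajectory p x y -> (x 0, y 0) = (a, b) ->
  [bounded x t | t in [set: R]] -> [bounded y t | t in [set: R]] ->
  solution p a b x y.
Proof.
move=> p0 xy xy0 bx by_; have [xc yc] := trajectory_continuous _ _ _ xy.
have xE : x^`() = y.
  by apply/funext => t; rewrite derive1E; have [[_ ->]] := xy t.
have yE : y^`() = fun t => (1 - p)^-1 * x t - signed_power p (x t) - 2^-1 * t * y t.
  by apply/funext => t; rewrite derive1E; have [_ [_ ->]] := xy t.
split => //; split.
- by move=> t; have [[]] := xy t.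
- by rewrite xE.
- by move=> t; have [_ []] := xy t.
- rewrite yE => t; apply: cvgB; last first.
    by apply: cvgM; [apply: cvgMl_tmp; exact: cvg_id|exact: yc].
  apply: cvgB; first by apply: cvgMl_tmp; exact: xc.
  exact: (continuous_cvg _ (@continuous_signed_power _ _ p0 (x t)) (xc t)).
- by rewrite xE.
- by rewrite yE.
Qed.

Lemma continuous_V {R : realType} (p : R) : 0 < p -> continuous (V p).
Proof.
move=> p0 w.
have w1 : fst v @[v --> w] --> w.1 by exact: cvg_fst.
have w2 : snd v @[v --> w] --> w.2 by exact: cvg_snd.
apply: cvgD; last first.
  apply: cvgMl_tmp.
  have c : {for w.1, continuous (fun u : R => `|u| `^ (1 + p))}.
    apply: differentiable_continuous; apply/derivable1_diffP.
    by have [] := is_derive_normr_powR p w.1 p0.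
  exact: (continuous_cvg _ c w1).
by apply: cvgB; apply: cvgMl_tmp; apply: cvgM.
Qed.

Lemma closure_le {T : topologicalType} {R : realType} (A : set T) (f : T -> R)
    (c : R) : continuous f -> (forall w, A w -> f w <= c) ->
  forall z, closure A z -> f z <= c.
Proof.
move=> fc fA z Az; rewrite leNgt; apply/negP => cz.
have [w [Aw]] := Az _ (cvgr_gt _ (fc z) _ cz).
by rewrite /= ltNge fA.
Qed.

(** Closure gives the weak inequalities. If [|a| = xeq p], then [V_xeq] forces [b = 0], one of the
    removed points. *)
Lemma Dbar'_bounds {R : realType} (p a b : R) : 0 < p -> p < 1 ->
  Dbar' p (a, b) ->
  [/\ `|a| < xeq p, V p (a, b) <= cstar p & (a, b) != (0, 0)].
Proof.
move=> p0 p1 [cl ne].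
have Vc : V p (a, b) <= cstar p.
  by apply: (closure_le _ _ _ (continuous_V p p0) _ _ cl) => w [_ /ltW].
have ax : `|a| <= xeq p.
  apply: (@closure_le _ _ _ (fun w : R * R => `|w.1|) _ _ _ _ cl).
    by move=> w; apply: cvg_norm; exact: cvg_fst.
  by move=> w [/ltW].
split => //; last by apply/eqP => ab; apply: ne; right.
rewrite lt_neqAle ax andbT; apply/eqP => aE; apply: ne; left.
move: Vc; rewrite V_xeq// gerDr pmulr_rle0// => b0.
have -> : b = 0 by apply/eqP; rewrite -sqrf_eq0 eq_le b0 sqr_ge0.
have [a0|a0] := leP 0 a; [right|left]; rewrite -aE.
  by rewrite ger0_norm.
by rewrite ltr0_norm// opprK.
Qed.

Lemma trajectory_invariance {R : realType} (p a b : R) (x y : R -> R) :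
  0 < p -> p < 1 -> Dbar' p (a, b) -> trajectory p x y -> (x 0, y 0) = (a, b) ->
  forall t, t != 0 -> D p (V p (a, b)) (x t, y t).
Proof.
move=> p0 p1 /(Dbar'_bounds p a b p0 p1)[ax Vc n0] xy xy0 t t0.
have [xa yb] : x 0 = a /\ y 0 = b by case: xy0.
have [tlt|tgt|tE] := ltgtP t 0; last by rewrite tE eqxx in t0.
  (* Negative times are positive times of the reversed trajectory; [V] is even in [y]. *)
  have := trajectory_in_D p _ _ p0 p1 (trajectory_rev _ _ _ xy).
  rewrite oppr0 xa yb V_rev xpair_eqE oppr_eq0 -xpair_eqE => /(_ ax Vc n0 (- t)).
  by rewrite oppr_gt0 /D /= !V_rev opprK; apply.
by have := trajectory_in_D p _ _ p0 p1 xy; rewrite xa yb => /(_ ax Vc n0 t tgt).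
Qed.

Lemma bounded_setT {R : realType} (f : R -> R) (M : R) :
  (forall t, `|f t| <= M) -> [bounded f t | t in [set: R]].
Proof.
move=> fM; exists M; split; first exact: num_real.
by move=> N MN t _ /=; exact: le_trans (fM t) (ltW MN).
Qed.

(** Dropping the nonnegative power term bounds [y ^+ 2]; then [|y| <= 1 + y ^+ 2] avoids a square
    root. *)
Lemma V_bound {R : realType} (p c x y : R) : 0 < p -> p < 1 ->
  `|x| <= xeq p -> V p (x, y) <= c ->
  `|y| <= 1 + 2 * (c + (2 * (1 - p))^-1 * xeq p ^+ 2).
Proof.
move=> p0 p1 xx; rewrite /V /= => Vc.
have q0 : 0 <= (2 * (1 - p))^-1 by rewrite invr_ge0 mulr_ge0// subr_ge0 ltW.
have r0 : 0 <= (1 + p)^-1 * `|x| `^ (1 + p).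
  by rewrite mulr_ge0 ?powR_ge0// invr_ge0 addr_ge0// ltW.
have x2 : (2 * (1 - p))^-1 * x ^+ 2 <= (2 * (1 - p))^-1 * xeq p ^+ 2.
  by rewrite ler_wpM2l// -(real_normK (num_real x)) lerXn2r ?nnegrE// ltW ?xeq_gt0.
have y2 : `|y| ^+ 2 <= 2 * (c + (2 * (1 - p))^-1 * xeq p ^+ 2).
  by rewrite (real_normK (num_real y)); lra.
by have := normr_ge0 y; clear -y2; nra.
Qed.

Theorem corollary4 (R : realType) (p : R) (hp0 : 0 < p) (hp1 : p < 1)
    (a b : R) (hab : Dbar' p (a, b)) :
  (exists x y : R -> R, solution p a b x y) /\
  (forall x y : R -> R, solution p a b x y ->
    forall t : R, t != 0 -> D p (V p (a, b)) (x t, y t)).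
Proof.
split; last first.
  move=> x y sol; have xy := solution_trajectory _ _ _ _ _ sol.
  by apply: trajectory_invariance => //; case: sol.
have [x [y [xy xy0]]] := trajectory_exists p a b hp0 hp1.
(* Weak inequalities include [t = 0], and they suffice to bound both components on the whole
   line. *)
have xyD t : `|x t| <= xeq p /\ V p (x t, y t) <= V p (a, b).
  have [->|t0] := eqVneq t 0.
    have [/ltW ax _ _] := Dbar'_bounds p a b hp0 hp1 hab.
    by case: xy0 => -> ->; split.
  by have [/ltW + /ltW] := trajectory_invariance _ _ _ _ _ hp0 hp1 hab xy xy0 _ t0.
exists x, y; apply: trajectory_solution => //.
  exact: (bounded_setT _ _ (fun t => proj1 (xyD t))).
exact: (bounded_setT _ _
  (fun t => V_bound _ _ _ _ hp0 hp1 (proj1 (xyD t)) (proj2 (xyD t)))).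
Qed.
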